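(* Let $N, W, L, M$ be positive integers and let $\mathbf{w}=(w[0],\dots,w[W-1])^T\in\mathbb{C}^W$ be a window such that (i) $\mathbf{w}$ is non-vanishing, i.e. $w[n]\neq 0$ for all $0\le n\le W-1$; (ii) $L<W\le \frac{N}{2}$; (iii) $2W\le M\le N$. Then for almost all non-vanishing signals $\mathbf{x}\in\mathbb{C}^N$ (i.e. all $\mathbf{x}$ with $x[n]\neq0$ for every $n$, except those in a subset of Lebesgue measure zero), the following holds: if $\mathbf{y}\in\mathbb{C}^N$ satisfies $Z_w^{\mathbf{y}}[m,r]=Z_w^{\mathbf{x}}[m,r]$ for all $1\le m\le M$ and $0\le r\le R-1$, then $\mathbf{y}=e^{i\phi}\mathbf{x}$ for some real $\phi$. That is, $\mathbf{x}$ is uniquely determined, up to a global phase, by its STFT magnitude measurements.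
   Context: Signals $\mathbf{x}=(x[0],\dots,x[N-1])^T\in\mathbb{C}^N$; the window is extended by $w[k]=0$ for $k\notin\{0,\dots,W-1\}$. The STFT of $\mathbf{x}$ with respect to $\mathbf{w}$ with shift $L$ is $Y_w^{\mathbf{x}}[m,r]=\sum_{n=0}^{N-1}x[n]\,w[rL-n]\,e^{-i2\pi mn/N}$ for integers $m$ (indices taken modulo $N$) and $0\le r\le R-1$, where $R=\lceil (N+W-1)/L\rceil$ is the number of short-time sections. The STFT magnitude measurements are $Z_w^{\mathbf{x}}[m,r]=|Y_w^{\mathbf{x}}[m,r]|^2$. *)

(* Defs.v *)
From HB Require Import structures.
From mathcomp Require Import all_boot all_order all_algebra.
From mathcomp Require Import complex.
From mathcomp Require Import reals trigo.
Set Implicit Arguments. Unset Strict Implicit. Unset Printing Implicit Defensive.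
Import Order.TTheory GRing.Theory Num.Theory.
Local Open Scope ring_scope.
Local Open Scope complex_scope.

Definition expi (R : realType) (theta : R) : R[i] := (cos theta) +i* (sin theta).

Definition wext (R : realType) (W : nat) (w : 'I_W -> R[i]) (k : int) : R[i] :=
  match k with
  | Posz n => if (n < W)%N =P true is ReflectT H then w (Ordinal H) else 0
  | Negz _ => 0
  end.

Definition nsect (N W L : nat) : nat := ((N + W - 1) + (L - 1)) %/ L.

Definition stft (R : realType) (N W L : nat) (w : 'I_W -> R[i])
  (x : 'I_N -> R[i]) (m r : nat) : R[i] :=
  \sum_(n < N) x n * wext w ((r * L)%:Z - (n : nat)%:Z)
     * expi (- (2 * pi * (m%:R) * (n%:R) / (N%:R)) : R).

Definition stft_mag (R : realType) (N W L : nat) (w : 'I_W -> R[i])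
  (x : 'I_N -> R[i]) (m r : nat) : R[i] :=
  `| stft L w x m r | ^+ 2.

(* Lebesgue null sets in C^N, identified with R^(2N) via real and imaginary
   parts: S is null iff for every eps > 0 it is covered by a countable family
   of closed boxes whose total volume is < eps. *)
Definition in_box (R : realType) (N : nat) (lo hi : 'I_N -> R[i]) (z : 'I_N -> R[i]) :=
  forall i, [/\ complex.Re (lo i) <= complex.Re (z i), complex.Re (z i) <= complex.Re (hi i),
               complex.Im (lo i) <= complex.Im (z i) & complex.Im (z i) <= complex.Im (hi i)].

Definition box_vol (R : realType) (N : nat) (lo hi : 'I_N -> R[i]) : R :=
  \prod_(i < N) ((complex.Re (hi i) - complex.Re (lo i)) * (complex.Im (hi i) - complex.Im (lo i))).

Definition lebesgue_null (R : realType) (N : nat) (S : ('I_N -> R[i]) -> Prop) :=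
  forall eps : R, 0 < eps ->
  exists lo hi : nat -> 'I_N -> R[i],
    (forall k i, complex.Re (lo k i) <= complex.Re (hi k i) /\ complex.Im (lo k i) <= complex.Im (hi k i)) /\
    (forall z, S z -> exists k, in_box (lo k) (hi k) z) /\
    (forall n, \sum_(k < n) box_vol (lo k) (hi k) < eps).

(* Main.v *)
Require Import Defs.
From HB Require Import structures.
From mathcomp Require Import all_boot all_order all_algebra.
From mathcomp Require Import complex.
From mathcomp Require Import boolp reals trigo.
From mathcomp Require Import zify ring lra.
Set Implicit Arguments. Unset Strict Implicit. Unset Printing Implicit Defensive.
Import Order.TTheory GRing.Theory Num.Theory.
Local Open Scope ring_scope.

(** The [r]-th section of a signal is a polynomial p of degree d < W, and the
    measurements of that section are |p|^2 at more than 2d points of the unit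
    circle, so they determine p times its conjugate reversal.  If q is another
    polynomial with the same product and q(0) = p(0), then a gcd argument shows
    that q = p unless p has a nonconstant factor f with |f(0)| = |lead f|.  The
    polynomials having such a factor form a null set: after rescaling f they are
    the image, under a polynomial map C^N -> C^N, of a real hyperplane.
    Outside these null sets, consecutive sections overlap because L < W: the
    first entry of each section is already known, and the signal is recovered
    section by section once the phase of its first entry is fixed. *)

Section ConjugateReversal.
Variable C : numClosedFieldType.
Implicit Types (p q f g : {poly C}).

Definition conjrev n p : {poly C} := \poly_(i < n.+1) (p`_(n - i))^*.

Lemma horner_conjrev n p x : (size p <= n.+1)%N -> x != 0 ->
  (conjrev n p).[x] = x ^+ n * (p.[(x^*)^-1])^*.
Proof.
move=> sp x0; rewrite horner_poly (horner_coef_wide _ sp) rmorph_sum mulr_sumr.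
rewrite (reindex_inj rev_ord_inj) /=; apply: eq_bigr => i _.
have i_le : (i <= n)%N by rewrite -ltnS.
rewrite subSS subKn // rmorphM /= rmorphXn /= fmorphV /= conjCK mulrCA.
have -> : x ^+ n = x ^+ (n - i) * x ^+ i by rewrite -exprD subnK.
by rewrite exprVn mulfK // expf_neq0.
Qed.

Lemma horner_nonzero_inj p q : (forall x, x != 0 -> p.[x] = q.[x]) -> p = q.
Proof.
move=> pq; apply/eqP; rewrite -subr_eq0; apply/negPn/negP => d0.
pose rs : seq C := [seq k.+1%:R | k <- iota 0 (size (p - q)%R)].
have : (size rs < size (p - q)%R)%N.
  apply: max_poly_roots => //.
    apply/allP => _ /mapP[k _ ->].
    by rewrite rootE hornerD hornerN pq ?subrr // pnatr_eq0.
  by rewrite map_inj_uniq ?iota_uniq // => i j /eqP; rewrite eqr_nat => /eqP[].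
by rewrite size_map size_iota ltnn.
Qed.

Lemma conjrevM m n p q : (size p <= m.+1)%N -> (size q <= n.+1)%N ->
  conjrev (m + n) (p * q) = conjrev m p * conjrev n q.
Proof.
move=> sp sq; apply: horner_nonzero_inj => x x0.
have spq : (size (p * q)%R <= (m + n).+1)%N.
  apply: leq_trans (size_polyMleq _ _) _.
  by move: (size p) (size q) sp sq; lia.
rewrite hornerM !horner_conjrev // hornerM rmorphM /= exprD.
by rewrite mulrACA.
Qed.

Lemma conjrev0 n p : (conjrev n p)`_0 = (p`_n)^*.
Proof. by rewrite coef_poly subn0. Qed.

Lemma coef_conjrev_last n p : (conjrev n p)`_n = (p`_0)^*.
Proof. by rewrite coef_poly ltnSn subnn. Qed.

Lemma size_conjrev n p : p`_0 != 0 -> size (conjrev n p) = n.+1.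
Proof.
by move=> p0; rewrite size_poly_eq // subnn conjC_eq0.
Qed.

Lemma eq_mul_conjrev n p q (rs : seq C) :
  (size p <= n.+1)%N -> (size q <= n.+1)%N ->
  uniq rs -> (n.*2 < size rs)%N -> {in rs, forall x, `|x| = 1} ->
  {in rs, forall x, `|p.[x]| = `|q.[x]|} ->
  p * conjrev n p = q * conjrev n q.
Proof.
move=> sp sq urs srs rs1 pq; apply/eqP; rewrite -subr_eq0; apply/negPn/negP => d0.
have hor (r : {poly C}) x : (size r <= n.+1)%N -> x \in rs ->
    (r * conjrev n r).[x] = x ^+ n * `|r.[x]| ^+ 2.
  move=> sr xrs; have x0 : x != 0 by rewrite -normr_eq0 rs1 // oner_eq0.
  have xV : (x^*)^-1 = x.
    by rewrite invC_norm norm_conjC rs1 // expr1n invr1 mul1r conjCK.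
  by rewrite hornerM horner_conjrev // xV normCK mulrCA.
have : (size rs < size (p * conjrev n p - q * conjrev n q)%R)%N.
  apply: max_poly_roots => //; apply/allP => x xrs.
  by rewrite rootE hornerD hornerN !hor // pq // subrr.
have sz (r : {poly C}) : (size r <= n.+1)%N -> (size (r * conjrev n r)%R <= n.*2.+1)%N.
  move=> sr; apply: leq_trans (size_polyMleq _ _) _.
  have sc : (size (conjrev n r) <= n.+1)%N by apply: size_poly.
  by move: (size r) (size _) sr sc; lia.
move/leq_trans/(_ (size_polyD _ _)); rewrite size_polyN ltnNge.
by rewrite geq_max !(leq_trans (sz _ _)).
Qed.

(* With g = gcd(p, q), p = g f and q = g h, coprimality of f and h forces h to
   be a multiple of the conjugate reversal of f; comparing extreme
   coefficients then gives |f(0)| = |lead f|. *)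
Lemma conjrev_factorization n p q :
  size p = n.+1 -> (size q <= n.+1)%N -> p`_0 != 0 -> q`_0 = p`_0 ->
  p * conjrev n p = q * conjrev n q ->
  p = q \/ exists g f, [/\ p = g * f, (1 < size f)%N & `|f`_0| = `|lead_coef f|].
Proof.
move=> sp sq p0 q0 pq.
have pn0 : p`_n != 0.
  by rewrite -[n]/(n.+1.-1) -sp -lead_coefE lead_coef_eq0 -size_poly_eq0 sp.
have qn : q`_n = p`_n.
  have := congr1 (fun r : {poly C} => r`_0) pq.
  rewrite !coef0M !conjrev0 q0 => /(mulfI p0) /(congr1 (fun z => z^*)).
  by rewrite !conjCK.
have szq : size q = n.+1.
  apply/eqP; rewrite eqn_leq sq ltnNge; apply: contra pn0 => sqn.
  by rewrite -qn nth_default.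
have p_neq0 : p != 0 by rewrite -size_poly_eq0 sp.
set g := gcdp p q.
have g_neq0 : g != 0 by rewrite gcdp_eq0 negb_and p_neq0.
pose f := p %/ g; pose h := q %/ g.
have pE : p = g * f by rewrite mulrC divpK // dvdp_gcdl.
have qE : q = g * h by rewrite mulrC divpK // dvdp_gcdr.
have cop : coprimep f h.
  by apply: coprimep_div_gcd; rewrite p_neq0.
have f0 : f != 0 by apply: contraNneq p_neq0 => f0; rewrite pE f0 mulr0.
have h0 : h != 0.
  by apply/eqP => h0; move: szq; rewrite qE h0 mulr0 size_poly0.
have g00 : g`_0 != 0 by apply: contraNneq p0 => g00; rewrite pE coef0M g00 mul0r.
have fh0 : h`_0 = f`_0.
  by apply: (mulfI g00); rewrite -!coef0M -pE -qE.
have fh_lead : lead_coef h = lead_coef f.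
  have lg : lead_coef g != 0 by rewrite lead_coef_eq0.
  by apply: (mulfI lg); rewrite -!lead_coefM -pE -qE !lead_coefE sp szq.
have sfh : size h = size f.
  move: szq; rewrite -sp pE qE !size_mul // => /(congr1 S).
  by rewrite !prednK ?addn_gt0 ?size_poly_gt0 ?g_neq0 // => /addnI.
have f00 : f`_0 != 0.
  by apply: contraNneq p0 => f00; rewrite pE coef0M f00 mulr0.
case sf : (size f) => [|[|e]].
- by move/eqP: sf; rewrite size_poly_eq0 (negPf f0).
- left; rewrite pE qE; congr (_ * _).
  rewrite (size1_polyC (eq_leq sf)) (@size1_polyC _ h) ?sfh ?sf //.
  by rewrite fh0.
right; exists g, f; rewrite sf; split => //.
set k := (size g).-1; have sg : size g = k.+1 by rewrite prednK // size_poly_gt0.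
have nE : n = (k + e.+1)%N.
  by move: sp; rewrite pE size_mul // sg sf addSn /= addnS => -[].
have key : f * conjrev e.+1 f = h * conjrev e.+1 h.
  have gg0 : g * conjrev k g != 0.
    by rewrite mulf_neq0 // -size_poly_eq0 size_conjrev.
  apply: (mulfI gg0); rewrite mulrACA -conjrevM ?sg ?sf // -pE -nE pq.
  by rewrite mulrACA -conjrevM ?sg ?sfh ?sf // -qE -nE.
have fdvd : f %| conjrev e.+1 h.
  by rewrite -(Gauss_dvdpr _ cop) -key dvdp_mulr.
have [c cE] : exists c, conjrev e.+1 h = c *: f.
  have : f %= conjrev e.+1 h.
    by rewrite -dvdp_size_eqp // size_conjrev ?sf // fh0.
  case/eqpP => -[a b] /= /andP[a0 b0] ab; exists (b^-1 * a).
  by rewrite -scalerA ab scalerA mulVf // scale1r.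
have lf : lead_coef f = f`_e.+1 by rewrite lead_coefE sf.
have lh : lead_coef f = h`_e.+1 by rewrite -fh_lead lead_coefE sfh sf.
have c1 : (lead_coef f)^* = c * f`_0.
  by rewrite lh -conjrev0 cE coefZ.
have c2 : (f`_0)^* = c * lead_coef f.
  by rewrite -fh0 -(coef_conjrev_last e.+1 h) cE coefZ lf.
have n1 : `|lead_coef f| = `|c| * `|f`_0| by rewrite -normrM -c1 norm_conjC.
have n2 : `|f`_0| = `|c| * `|lead_coef f| by rewrite -normrM -c2 norm_conjC.
have nc : `|c| ^+ 2 = 1.
  have nf0 : `|f`_0| != 0 by rewrite normr_eq0.
  by apply: (mulIf nf0); rewrite mul1r {2}n2 n1 mulrA.
have /eqP := nc; rewrite sqrp_eq1 ?normr_ge0 // => /eqP nc1.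
by rewrite n1 nc1 mul1r.
Qed.

End ConjugateReversal.

Local Open Scope complex_scope.

Section NullSets.
Variables (R : realType) (N : nat).
Hypothesis N0 : (0 < N)%N.
Implicit Types (S : ('I_N -> R[i]) -> Prop) (lo hi : 'I_N -> R[i]).

Definition box lo hi := forall i, complex.Re (lo i) <= complex.Re (hi i)
  /\ complex.Im (lo i) <= complex.Im (hi i).

Lemma box_vol_ge0 lo hi : box lo hi -> 0 <= box_vol lo hi.
Proof.
by move=> lh; apply: prodr_ge0 => i _; have [? ?] := lh i; rewrite mulr_ge0 ?subr_ge0.
Qed.

Lemma box_vol_point lo : box_vol lo lo = 0.
Proof. by rewrite /box_vol (bigD1 (Ordinal N0)) //= !subrr !mul0r. Qed.

Lemma lebesgue_null_countable S :
  (forall eps : R, 0 < eps -> exists (T : countType) (lo hi : T -> 'I_N -> R[i]),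
    [/\ forall t, box (lo t) (hi t),
        forall z, S z -> exists t, in_box (lo t) (hi t) z
      & forall s : seq T, uniq s -> \sum_(t <- s) box_vol (lo t) (hi t) < eps]) ->
  lebesgue_null S.
Proof.
move=> cover eps /cover[T [lo [hi [lohi covS volS]]]].
pose ext (f : T -> 'I_N -> R[i]) k := if pickle_inv k is Some t then f t else fun=> 0.
exists (ext lo), (ext hi); split; last split.
- by move=> k i; rewrite /ext; case: pickle_inv => [t|] //; apply: lohi.
- move=> z /covS[t zt]; exists (pickle t).
  by rewrite /ext pickleK_inv.
move=> n; rewrite (_ : \sum_(k < n) _ =
    \sum_(t <- pmap pickle_inv (iota 0 n)) box_vol (lo t) (hi t)).
  by apply/volS/(pmap_uniq (@pickle_invK T))/iota_uniq.
rewrite -(big_mkord xpredT (fun k => box_vol (ext lo k) (ext hi k))) /index_iota subn0.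
elim: iota => [|k s IH] /=; first by rewrite !big_nil.
rewrite big_cons IH {1 2}/ext; case: pickle_inv => [t|] /=; first by rewrite big_cons.
by rewrite box_vol_point add0r.
Qed.

Lemma lebesgue_null_empty : lebesgue_null (fun _ : 'I_N -> R[i] => False).
Proof.
move=> eps eps0; exists (fun _ => fun=> 0), (fun _ => fun=> 0); do !split => //.
by move=> n; rewrite big1 // => k _; apply: box_vol_point.
Qed.

Lemma geometric_half_sum (eps : R) m :
  \sum_(i < m) eps / 2 ^+ i.+1 = eps - eps / 2 ^+ m.
Proof.
elim: m => [|m IH]; first by rewrite big_ord0 expr0 divr1 subrr.
rewrite big_ord_recr /= IH exprS; field.
by rewrite expf_neq0 ?pnatr_eq0.
Qed.

Lemma le_sum_pairs (f : nat * nat -> R) (s : seq (nat * nat)) m :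
  (forall p, 0 <= f p) -> uniq s -> {in s, forall p, (p.1 < m)%N && (p.2 < m)%N} ->
  \sum_(p <- s) f p <= \sum_(i < m) \sum_(j < m) f (i : nat, j : nat).
Proof.
move=> f0 us sm.
pose L := [seq (i, j) | i <- iota 0 m, j <- iota 0 m].
have uL : uniq L by apply: allpairs_uniq; rewrite ?iota_uniq // => -[? ?] [? ?].
have -> : \sum_(p <- s) f p = \sum_(p <- L | p \in s) f p.
  rewrite -[RHS]big_filter; apply: perm_big; apply: uniq_perm => //.
    exact: filter_uniq.
  move=> p; rewrite mem_filter; have [ps|//] := boolP (p \in s).
  apply/esym/allpairsP; exists p; rewrite !mem_iota /= !add0n.
  by have /andP[-> ->] := sm _ ps; case: (p).
have -> : \sum_(i < m) \sum_(j < m) f (i : nat, j : nat) = \sum_(p <- L) f p.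
  rewrite big_allpairs -(big_mkord xpredT (fun i => \sum_(j < m) f (i, j : nat))).
  rewrite /index_iota subn0; apply: eq_bigr => i _.
  by rewrite -(big_mkord xpredT (fun j => f (i, j))) /index_iota subn0.
by rewrite big_mkcond; apply: ler_sum => p _; case: ifP.
Qed.

Lemma lebesgue_null_bigcup (S : nat -> ('I_N -> R[i]) -> Prop) :
  (forall k, lebesgue_null (S k)) -> lebesgue_null (fun z => exists k, S k z).
Proof.
move=> nullS; apply: lebesgue_null_countable => eps eps0.
pose covers k (F : (nat -> 'I_N -> R[i]) * (nat -> 'I_N -> R[i])) :=
  [/\ forall j, box (F.1 j) (F.2 j),
      forall z, S k z -> exists j, in_box (F.1 j) (F.2 j) z
    & forall n, \sum_(j < n) box_vol (F.1 j) (F.2 j) < eps / 2 ^+ k.+1].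
have [k|f fP] := @choice _ _ covers.
  have [|lo [hi [? [? ?]]]] := nullS k (eps / 2 ^+ k.+1).
    by rewrite divr_gt0 ?exprn_gt0.
  by exists (lo, hi).
exists (nat * nat)%type, (fun p => (f p.1).1 p.2), (fun p => (f p.1).2 p.2); split.
- by move=> p; have [+ _ _] := fP p.1; apply.
- by move=> z [k /(let: And3 _ h _ := fP k in h z) [j zj]]; exists (k, j).
move=> s us.
have [m sm] : exists m, {in s, forall p, (p.1 < m)%N && (p.2 < m)%N}.
  elim: s {us} => [|[a b] s [m IH]]; first by exists 0%N.
  exists (a + b + m).+1 => -[c d]; rewrite inE => /predU1P[[-> ->]|/IH] /=; lia.
apply: le_lt_trans (le_sum_pairs _ us sm) _ => [p|].
  by apply: box_vol_ge0; have [+ _ _] := fP p.1; apply.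
have : 0 < eps / 2 ^+ m by rewrite divr_gt0 ?exprn_gt0.
suff : \sum_(i < m) \sum_(j < m) box_vol ((f i).1 j) ((f i).2 j)
    <= eps - eps / 2 ^+ m by move=> /=; lra.
rewrite -geometric_half_sum; apply: ler_sum => i _.
by have [_ _ /(_ m)/ltW] := fP i.
Qed.

Lemma lebesgue_null_sub S S' : (forall z, S' z -> S z) ->
  lebesgue_null S -> lebesgue_null S'.
Proof.
move=> sub nullS eps /nullS[lo [hi [? [cov ?]]]]; exists lo, hi; do !split => //.
by move=> z /sub/cov.
Qed.

Definition loc_lip (f : ('I_N -> R[i]) -> R[i]) := forall B : R[i],
  exists K : R[i], forall (z z' : 'I_N -> R[i]) (d : R[i]), 0 <= d ->
    (forall i, `|z i| <= B) -> (forall i, `|z' i| <= B) ->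
    (forall i, `|z i - z' i| <= d) ->
    `|f z| <= K /\ `|f z - f z'| <= K * d.

Lemma loc_lip_cst c : loc_lip (fun=> c).
Proof.
by move=> B; exists `|c| => z z' d d0 _ _ _; rewrite subrr normr0 mulr_ge0.
Qed.

Lemma loc_lip_proj i : loc_lip (fun z => z i).
Proof.
move=> B; exists (B + 1) => z z' d d0 /(_ i) zB _ /(_ i) zz'; split.
  by rewrite (le_trans zB) // lerDl.
have B0 : 0 <= B by apply: le_trans zB.
by rewrite (le_trans zz') // ler_peMl // lerDr.
Qed.

Lemma loc_lipD f g : loc_lip f -> loc_lip g -> loc_lip (fun z => f z + g z).
Proof.
move=> lf lg B; have [[Kf fK] [Kg gK]] := (lf B, lg B).
exists (Kf + Kg) => z z' d d0 zB z'B zz'.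
have [f1 f2] := fK z z' d d0 zB z'B zz'; have [g1 g2] := gK z z' d d0 zB z'B zz'.
split; first by apply: le_trans (ler_normD _ _) _; apply: lerD.
by rewrite opprD addrACA mulrDl; apply: le_trans (ler_normD _ _) _; apply: lerD.
Qed.

Lemma loc_lipM f g : loc_lip f -> loc_lip g -> loc_lip (fun z => f z * g z).
Proof.
move=> lf lg B; have [[Kf fK] [Kg gK]] := (lf B, lg B).
exists (Kf * Kg + Kf * Kg) => z z' d d0 zB z'B zz'.
have [f1 f2] := fK z z' d d0 zB z'B zz'; have [g1 g2] := gK z z' d d0 zB z'B zz'.
have zz'C i : `|z' i - z i| <= d by rewrite distrC.
have [_ _] := fK z' z d d0 z'B zB zz'C; have [g3 _] := gK z' z d d0 z'B zB zz'C.
have Kf0 : 0 <= Kf by apply: le_trans f1.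
have Kg0 : 0 <= Kg by apply: le_trans g1.
split.
  rewrite normrM (@le_trans _ _ (Kf * Kg)) ?ler_pM //.
  by rewrite lerDl mulr_ge0.
have -> : f z * g z - f z' * g z' = f z * (g z - g z') + (f z - f z') * g z' by ring.
apply: le_trans (ler_normD _ _) _; rewrite [leRHS]mulrDl !normrM; apply: lerD.
  by rewrite -mulrA ler_pM.
by rewrite mulrAC ler_pM.
Qed.

Lemma loc_lip_sum (I : Type) (r : seq I) (P : pred I) F :
  (forall i, loc_lip (F i)) -> loc_lip (fun z => \sum_(i <- r | P i) F i z).
Proof.
move=> lF; elim: r => [|i r IH].
  rewrite (_ : (fun z => _) = fun=> 0); first exact: loc_lip_cst.
  by apply/funext => z; rewrite big_nil.
case Pi : (P i); last first.
  by under [X in loc_lip X]funext do rewrite big_cons Pi.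
under [X in loc_lip X]funext do rewrite big_cons Pi.
exact: loc_lipD.
Qed.

Lemma normc_le_ReIm (z : R[i]) : `|z| <= (`|complex.Re z| + `|complex.Im z|)%:C.
Proof.
rewrite normc_def lecR -[leRHS]ger0_norm ?addr_ge0 // -sqrtr_sqr ler_wsqrtr //.
by rewrite sqrrD !real_normK ?num_real // addrAC lerDl mulrn_wge0 ?mulr_ge0.
Qed.

Lemma normc_leP (z : R[i]) (a : R) : `|z| <= a%:C ->
  `|complex.Re z| <= a /\ `|complex.Im z| <= a.
Proof.
rewrite normc_def lecR => za.
by split; apply: le_trans za; rewrite -sqrtr_sqr ler_wsqrtr // ?lerDl ?lerDr sqr_ge0.
Qed.

Lemma loc_lip_family (F : ('I_N -> R[i]) -> 'I_N -> R[i]) (B : R) :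
  0 <= B -> (forall n, loc_lip (fun z => F z n)) ->
  exists K : R, 0 <= K /\ forall (z z' : 'I_N -> R[i]) (d : R) n, 0 <= d ->
    (forall i, `|z i| <= B%:C) -> (forall i, `|z' i| <= B%:C) ->
    (forall i, `|z i - z' i| <= d%:C) -> `|F z n - F z' n| <= (K * d)%:C.
Proof.
move=> B0 lF; have [K KP] := choice (fun n => lF n B%:C).
have K0 n : 0 <= K n.
  have [||||+ _] := KP n (fun=> 0) (fun=> 0) 0 => // [i|i|i|].
  - by rewrite normr0 ler0c.
  - by rewrite normr0 ler0c.
  - by rewrite subrr normr0.
  by apply: le_trans.
have KE n : (complex.Re (K n))%:C = K n by rewrite RRe_real // ger0_real.
have ReK0 n : 0 <= complex.Re (K n) by rewrite -ler0c KE.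
exists (\sum_n complex.Re (K n)); split; first exact: sumr_ge0.
move=> z z' d n d0 zB z'B zz'.
have [|_ h] := KP n z z' d%:C _ zB z'B zz'; first by rewrite ler0c.
apply: le_trans h _; rewrite -KE -rmorphM lecR ler_wpM2r //.
by rewrite (bigD1 n) //= lerDl sumr_ge0.
Qed.

Lemma grid_approx (B : R) (k : nat) (x : R) : 0 < B -> `|x| < B ->
  exists q : 'I_k.+1, `|x - (- B + 2 * B * (q : nat)%:R / k.+1%:R)| <= 2 * B / k.+1%:R.
Proof.
move=> B0; rewrite ltr_norml => /andP[x1 x2].
have k0 : 0 < k.+1%:R :> R by rewrite ltr0n.
pose y := (x + B) / (2 * B) * k.+1%:R.
have y0 : 0 <= y by rewrite mulr_ge0 ?divr_ge0 //; lra.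
have yk : y < k.+1%:R.
  by rewrite -[ltRHS]mul1r ltr_pM2r // ltr_pdivrMr ?mulr_gt0 //; lra.
have /andP[q1 q2] := truncn_itv y0.
have qk : (Num.truncn y < k.+1)%N by rewrite truncn_lt_nat.
exists (Ordinal qk) => /=.
set q : R := (Num.truncn y)%:R in q1 *.
have {}q2 : y < q + 1 by rewrite /q natr1.
have -> : x - (- B + 2 * B * q / k.+1%:R) = 2 * B / k.+1%:R * (y - q).
  by rewrite /y; field; rewrite gt_eqF //= addrC natr1 gt_eqF.
rewrite normrM ger0_norm; last by rewrite divr_ge0 // mulr_ge0 // ltW.
by rewrite ler_piMr ?divr_ge0 ?mulr_ge0 // ?(ltW B0) // ger0_norm; lra.
Qed.

Lemma grid_bound (B : R) (k : nat) (q : 'I_k.+1) : 0 < B ->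
  `|- B + 2 * B * (q : nat)%:R / k.+1%:R| <= B.
Proof.
move=> B0; have k0 : 0 < k.+1%:R :> R by rewrite ltr0n.
have h0 : 0 <= 2 * B * (q : nat)%:R / k.+1%:R.
  by rewrite divr_ge0 ?mulr_ge0 // ltW.
have h1 : 2 * B * (q : nat)%:R / k.+1%:R <= 2 * B.
  by rewrite ler_pdivrMr // ler_wpM2l ?mulr_ge0 ?(ltW B0) // ler_nat ltnW.
by move: h0 h1; set T := (_ / _) => h0 h1; rewrite ler_norml; apply/andP; split; lra.
Qed.

Lemma card_grid_hyperplane (k : nat) (j : 'I_N) :
  #|[pred c : {ffun 'I_N -> 'I_k.+1 * 'I_k.+1} | (c j).2 == ord0]|
    = (k.+1 ^ (2 * N).-1)%N.
Proof.
pose F i : pred ('I_k.+1 * 'I_k.+1) := [pred p | (i == j) ==> (p.2 == ord0)].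
have -> : #|[pred c : {ffun 'I_N -> 'I_k.+1 * 'I_k.+1} | (c j).2 == ord0]|
    = #|(family F : pred {ffun 'I_N -> 'I_k.+1 * 'I_k.+1})|.
  apply: eq_card => c; rewrite !inE; apply/idP/familyP => [cj i|/(_ j)].
    by rewrite inE; apply/implyP => /eqP->.
  by rewrite inE eqxx.
rewrite card_family foldrE big_image /= (bigD1 j) //=.
have -> : #|F j| = k.+1.
  pose f (q : 'I_k.+1) := (q, ord0 : 'I_k.+1).
  rewrite -[RHS]card_ord -(card_image (f := f)); last by move=> ? ? [].
  apply: eq_card => -[p q]; rewrite !inE eqxx /=.
  apply/eqP/imageP => [->|[? _ [_ ->]]] //.
  by exists p.
rewrite (eq_bigr (fun=> (k.+1 ^ 2)%N)); last first.
  move=> i /negPf ij; rewrite (eq_card (B := predT)) ?card_prod ?card_ord ?mulnn //.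
  by move=> p; rewrite !inE ij.
rewrite prod_nat_const cardC1 card_ord -expnM -expnS; congr expn.
by case: N N0 => // n _; lia.
Qed.

Lemma lebesgue_null_image_bounded (j : 'I_N)
    (F : ('I_N -> R[i]) -> 'I_N -> R[i]) (B : R) :
  0 < B -> (forall n, loc_lip (fun z => F z n)) ->
  lebesgue_null (fun x => exists z : 'I_N -> R[i], [/\ complex.Im (z j) = 0,
    forall i, `|z i| < B%:C & forall n, x n = F z n]).
Proof.
move=> B0 lF; have [|K [K0 KP]] := @loc_lip_family F (2 * B) _ lF.
  by rewrite mulr_ge0 // ltW.
apply: lebesgue_null_countable => // eps eps0.
pose D := 8 * B * K; have D0 : 0 <= D by rewrite mulr_ge0 ?mulr_ge0 // ltW.
pose k := Num.truncn (D ^+ (2 * N) / eps).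
have kP : D ^+ (2 * N) / k.+1%:R < eps.
  by rewrite ltr_pdivrMr ?ltr0n // mulrC -ltr_pdivrMr // truncnS_gt.
pose h := 2 * B / k.+1%:R.
have h0 : 0 <= h by rewrite divr_ge0 ?mulr_ge0 // ltW.
pose grid (q : 'I_k.+1) : R := - B + 2 * B * (q : nat)%:R / k.+1%:R.
pose center (c : {ffun 'I_N -> 'I_k.+1 * 'I_k.+1}) i :=
  grid (c i).1 +i* (if i == j then 0 else grid (c i).2).
pose s := K * (2 * h); have s0 : 0 <= s by apply: mulr_ge0 => //; apply: mulr_ge0.
pose corner e (c : {ffun 'I_N -> 'I_k.+1 * 'I_k.+1}) n :=
  if (c j).2 == ord0 then F (center c) n + (e * s +i* (e * s)) else 0.
exists {ffun 'I_N -> 'I_k.+1 * 'I_k.+1}, (corner (-1)), (corner 1); split.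
- move=> c i; rewrite /corner; case: ifP => // _.
  by case: (F _ _) => a b /=; split; lra.
- move=> x [z [zj zB xF]].
  have ltB i : `|complex.Re (z i)| < B /\ `|complex.Im (z i)| < B.
    have := zB i; rewrite normc_def ltcR => zi.
    split; apply: le_lt_trans zi; rewrite -sqrtr_sqr ler_wsqrtr //.
      by rewrite lerDl sqr_ge0.
    by rewrite lerDr sqr_ge0.
  have [cr crP] := choice (fun i => grid_approx k B0 (proj1 (ltB i))).
  have [ci ciP] := choice (fun i => grid_approx k B0 (proj2 (ltB i))).
  pose c : {ffun 'I_N -> 'I_k.+1 * 'I_k.+1} :=
    [ffun i => (cr i, if i == j then ord0 else ci i)].
  exists c => n; rewrite /corner ffunE /= eqxx.
  have /normc_leP : `|F z n - F (center c) n| <= s%:C.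
    apply: KP => [|i|i|i]; first exact: mulr_ge0.
    + by apply: le_trans (ltW (zB i)) _; rewrite lecR; lra.
    + apply: le_trans (normc_le_ReIm _) _; rewrite lecR /= ffunE /=.
      have := grid_bound (cr i) B0; case: eqP => _.
        by rewrite normr0 /grid; lra.
      by have := grid_bound (ci i) B0; rewrite /grid; lra.
    have -> : z i - center c i = (complex.Re (z i) - grid (cr i))
        +i* (complex.Im (z i) - if i == j then 0 else grid (ci i)).
      by rewrite /center ffunE /=; case: (z i) => a b; case: eqP.
    apply: le_trans (normc_le_ReIm _) _; rewrite lecR /= mulr_natl mulr2n.
    apply: lerD; first exact: crP.
    case: eqP => [->|_]; last exact: ciP.
    by rewrite zj subrr normr0.
  rewrite xF; case: (F z n) (F (center c) n) => a b [a' b'] /=.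
  rewrite !ler_norml mulN1r mul1r => -[/andP[? ?] /andP[? ?]].
  by clearbody s; split; lra.
move=> t ut; rewrite big_uniq //=.
apply: le_lt_trans kP.
have volE c : box_vol (corner (-1) c) (corner 1 c) =
    if (c j).2 == ord0 then (2 * s) ^+ (2 * N) else 0.
  rewrite /corner; case: ifP => _; last exact: box_vol_point.
  rewrite /box_vol (eq_bigr (fun=> (2 * s) ^+ 2)).
    by rewrite prodr_const card_ord -exprM.
  by move=> n _; case: (F _ _) => a b /=; ring.
apply: (@le_trans _ _ (\sum_c box_vol (corner (-1) c) (corner 1 c))).
  rewrite [leRHS](bigID (mem t)) /= lerDl sumr_ge0 // => c _.
  by rewrite volE; case: ifP => // _; apply: exprn_ge0; apply: mulr_ge0.
rewrite (eq_bigr _ (fun c _ => volE c)) -big_mkcond /= sumr_const.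
rewrite card_grid_hyperplane -[leLHS]mulr_natr natrX.
have -> : 2 * s = D / k.+1%:R by rewrite /s /h /D; field; rewrite addrC natr1 pnatr_eq0.
have k0 : k.+1%:R != 0 :> R by rewrite pnatr_eq0.
have -> : (2 * N)%N = (2 * N).-1.+1 by rewrite prednK // muln_gt0.
by rewrite expr_div_n [k.+1%:R ^+ _.+1]exprS invfM mulrA divfK ?expf_neq0.
Qed.

Lemma lebesgue_null_image (j : 'I_N) (F : ('I_N -> R[i]) -> 'I_N -> R[i]) :
  (forall n, loc_lip (fun z => F z n)) ->
  lebesgue_null (fun x => exists z : 'I_N -> R[i], complex.Im (z j) = 0 /\
    forall n, x n = F z n).
Proof.
move=> lF; apply: (lebesgue_null_sub (S := fun x => exists B : nat,
  exists z : 'I_N -> R[i], [/\ complex.Im (z j) = 0,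
    forall i, `|z i| < B.+1%:R%:C & forall n, x n = F z n])).
  move=> x [z [zj xF]].
  pose M := \sum_i complex.Re `|z i|.
  exists (Num.truncn M), z; split=> // i.
  have zE l : (complex.Re `|z l|)%:C = `|z l| by rewrite RRe_real // ger0_real.
  rewrite -zE ltcR; apply: le_lt_trans (truncnS_gt _).
  by rewrite /M (bigD1 i) //= lerDl sumr_ge0 // => l _; rewrite -ler0c zE.
apply: lebesgue_null_bigcup => B.
by apply: lebesgue_null_image_bounded lF; rewrite ltr0n.
Qed.

End NullSets.

Section Flippable.
Variables (R : realType) (N : nat).
Implicit Types x z : 'I_N -> R[i].

Definition ext x (k : nat) : R[i] := oapp x 0 (insub k).

Lemma ext_ord x (n : 'I_N) : ext x n = x n.
Proof. by rewrite /ext valK. Qed.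

Lemma ext_fun (f : nat -> R[i]) k : (k < N)%N -> ext (fun n : 'I_N => f n) k = f k.
Proof. by move=> kN; rewrite -[k]/(val (Ordinal kN)) ext_ord. Qed.

Definition section_poly (v : nat -> R[i]) (a d : nat) x : {poly R[i]} :=
  \poly_(k < d.+1) (ext x (a + k) * v k).

Definition flippable (v : nat -> R[i]) (a d : nat) x := exists g f : {poly R[i]},
  [/\ section_poly v a d x = g * f, (1 < size f)%N & `|f`_0| = `|lead_coef f|].

Lemma unit_cayley (u : R[i]) : `|u| = 1 -> exists (b : bool) (t : R),
  (-1) ^+ b * (1 -i* t) = u * (1 +i* t).
Proof.
case: u => a b u1.
have ab1 : a ^+ 2 + b ^+ 2 = 1.
  by apply: complexI; rewrite (add_Re2_Im2 (a +i* b)) u1 expr1n.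
have [a1|a1] := eqVneq (1 + a) 0.
  have aE : a = -1 by lra.
  have bE : b = 0.
    by apply/eqP; rewrite -sqrf_eq0; apply/eqP; move: ab1; rewrite aE; lra.
  exists true, 0; rewrite expr1 aE bE; apply/eqP; rewrite eq_complex /=.
  by apply/andP; split; apply/eqP; ring.
exists false, (- b / (1 + a)); rewrite expr0 mul1r.
apply/eqP; rewrite eq_complex /=; apply/andP; split; apply/eqP.
  have -> : a * 1 - b * (- b / (1 + a)) = (a ^+ 2 + b ^+ 2 + a) / (1 + a) by field.
  by rewrite ab1 divff.
by field.
Qed.

(* Every factorization with [size f = e.+2] and |f(0)| = |lead f| rescales to
   one with lead f = 1 + it and f(0) = +-(1 - it); storing t in coordinate [a]
   and the free coefficients in the next ones costs one real dimension. *)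
Definition flip_factor (s : R[i]) (a e : nat) z : {poly R[i]} :=
  \poly_(k < e.+2) (if k == 0%N then s * (1 - 'i * ext z a)
    else if k == e.+1 then 1 + 'i * ext z a else ext z (a + k)).

Definition flip_cofactor (a d e : nat) z : {poly R[i]} :=
  \poly_(k < d - e) ext z (a + e.+1 + k).

Definition flip_map (v : nat -> R[i]) (s : R[i]) (a d e : nat) z (n : 'I_N) : R[i] :=
  if (a <= n <= a + d)%N
  then (flip_cofactor a d e z * flip_factor s a e z)`_(n - a) / v (n - a)%N
  else z n.

Lemma loc_lip_ext k : loc_lip (fun z : 'I_N -> R[i] => ext z k).
Proof.
rewrite /ext; case: insub => [i|] /=; [exact: loc_lip_proj | exact: loc_lip_cst].
Qed.

Lemma eq_loc_lip (f g : ('I_N -> R[i]) -> R[i]) : f =1 g -> loc_lip g -> loc_lip f.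
Proof. by move/funext->. Qed.

Lemma loc_lip_poly m (c : nat -> ('I_N -> R[i]) -> R[i]) k :
  (forall i, loc_lip (c i)) -> loc_lip (fun z => (\poly_(i < m) c i z)`_k).
Proof.
move=> lc; apply: (eq_loc_lip (g := fun z => if (k < m)%N then c k z else 0)).
  by move=> z; rewrite coef_poly.
by case: (k < m)%N; [exact: lc | exact: loc_lip_cst].
Qed.

Lemma loc_lip_flip_map v s a d e n : loc_lip (fun z => flip_map v s a d e z n).
Proof.
rewrite /flip_map; case: (a <= n <= a + d)%N; last exact: loc_lip_proj.
apply: loc_lipM; last exact: loc_lip_cst.
apply: (eq_loc_lip (g := fun z => \sum_(k < (n - a).+1)
  (flip_cofactor a d e z)`_k * (flip_factor s a e z)`_(n - a - k))).
  by move=> z; rewrite coefM.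
apply: loc_lip_sum => k; apply: loc_lipM; apply: loc_lip_poly => i.
  exact: loc_lip_ext.
have lip_it c : loc_lip (fun z : 'I_N -> R[i] => 1 + c * ext z a).
  apply: loc_lipD; first exact: loc_lip_cst.
  by apply: loc_lipM; [exact: loc_lip_cst | exact: loc_lip_ext].
case: (i == 0%N); last by case: (i == e.+1); [exact: lip_it | exact: loc_lip_ext].
apply: loc_lipM; first exact: loc_lip_cst.
by apply: eq_loc_lip (lip_it (- 'i)) => z; rewrite mulNr.
Qed.

Lemma flippable_image v a d x : (a + d < N)%N -> (forall k, (k <= d)%N -> v k != 0) ->
  (forall n, x n != 0) -> flippable v a d x ->
  exists e (b : bool) z, ext z a = (complex.Re (ext z a))%:C /\
    forall n, x n = flip_map v ((-1) ^+ b) a d e z n.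
Proof.
move=> adN v0 x0 [g [f [gf sf lf]]].
have szp : size (section_poly v a d x) = d.+1.
  rewrite size_poly_eq // mulf_neq0 ?v0 //.
  by rewrite -[(a + d)%N]/(val (Ordinal adN)) ext_ord.
have f0 : f != 0 by rewrite -size_poly_gt0 ltnW.
have g0 : g != 0.
  by apply/eqP => g0; move: szp; rewrite gf g0 mul0r size_poly0.
have [e sfe] : exists e, size f = e.+2 by case: (size f) sf => [|[|e]] // _; exists e.
have sg : size g = (d - e)%N.
  move: szp; rewrite gf size_mul // sfe; move: (size _) => m; lia.
have ed : (e < d)%N.
  by rewrite -subn_gt0 -sg size_poly_gt0.
have lf0 : lead_coef f != 0 by rewrite lead_coef_eq0.
have u1 : `|f`_0 / lead_coef f| = 1 by rewrite normf_div lf divff // normr_eq0.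
have [b [t bt]] := unit_cayley u1.
have t0 : 1 + 'i * t%:C != 0 :> R[i].
  by apply/eqP => -[]; rewrite mul0r mul1r !subr0 addr0 => /eqP; rewrite oner_eq0.
have tE1 : 1 +i* t = 1 + 'i * t%:C by rewrite [LHS]complexE.
have tE2 : 1 -i* t = 1 - 'i * t%:C by rewrite [LHS]complexE /= rmorphN mulrN.
pose rho := lead_coef f / (1 + 'i * t%:C).
have rho0 : rho != 0 by rewrite mulf_neq0 ?invr_eq0.
pose zn k := if (k < a)%N then ext x k else if k == a then t%:C else
  if (k < a + e.+1)%N then rho^-1 * f`_(k - a) else
  if (k <= a + d)%N then rho * g`_(k - (a + e.+1)) else ext x k.
pose z := fun n : 'I_N => zn n.
have za : ext z a = t%:C.
  by rewrite ext_fun ?(leq_trans _ adN) ?ltnS ?leq_addr // /zn ltnn eqxx.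
exists e, b, z; rewrite za; split => // n.
have fE : flip_factor ((-1) ^+ b) a e z = rho^-1 *: f.
  apply/polyP => k; rewrite coef_poly coefZ za.
  case: ltnP => ke; last by rewrite nth_default ?mulr0 // sfe.
  case: eqP => [->|/eqP k0].
    rewrite -tE2 bt tE1 /rho invf_div; field.
    by rewrite lf0.
  case: eqP => [->|/eqP ke1].
    by rewrite /rho invf_div -[f`_e.+1]/(f`_(e.+2.-1)) -sfe -lead_coefE divfK.
  have kd : (a + k < N)%N by lia.
  rewrite ext_fun // /zn ltnNge leq_addr /= -[X in _ == X]addn0 eqn_add2l (negPf k0).
  by rewrite ltn_add2l ifT ?addKn //; lia.
have gE : flip_cofactor a d e z = rho *: g.
  apply/polyP => k; rewrite coef_poly coefZ.
  case: ltnP => kd; last by rewrite nth_default ?mulr0 // sg.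
  rewrite ext_fun; last by lia.
  rewrite /zn; do 3 (rewrite ifF; last by lia).
  by rewrite ifT ?addKn //; lia.
rewrite /flip_map; case: ifP => [/andP[an nad]|an].
  have nd : (n - a <= d)%N by lia.
  rewrite fE gE -scalerAl -scalerAr scalerA mulfV // scale1r -gf coef_poly ltnS nd.
  by rewrite subnKC // mulfK ?v0 // ext_ord.
by rewrite /z /zn; case: ifP => [_|na]; rewrite ?ext_ord // !ifF ?ext_ord //; lia.
Qed.

Lemma lebesgue_null_flippable v a d : (a + d < N)%N ->
  (forall k, (k <= d)%N -> v k != 0) ->
  lebesgue_null (fun x => (forall n, x n != 0) /\ flippable v a d x).
Proof.
move=> adN v0; have aN : (a < N)%N by apply: leq_ltn_trans (leq_addr _ _) adN.
have N0 : (0 < N)%N by apply: leq_ltn_trans aN.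
apply: (lebesgue_null_sub (S := fun x => exists k : nat,
    exists z, complex.Im (z (Ordinal aN)) = 0 /\
    forall n, x n = flip_map v ((-1) ^+ odd k) a d k./2 z n)).
  move=> x [x0 /flippable_image[] // e [b [z [za xz]]]].
  exists (b + e.*2)%N, z; rewrite half_bit_double oddD odd_double addbF oddb.
  by split => //; rewrite -(ext_ord z) /= za.
apply: lebesgue_null_bigcup => // k; apply: lebesgue_null_image => // n.
exact: loc_lip_flip_map.
Qed.

End Flippable.

Section Circle.
Variable R : realType.
Implicit Types t : R.

Lemma expiD t s : expi (t + s) = expi t * expi s.
Proof.
rewrite /expi cosD sinD; apply/eqP; rewrite eq_complex /= addrC eqxx.
by apply/eqP; ring.
Qed.

Lemma expi0 : expi (0 : R) = 1.
Proof. by rewrite /expi cos0 sin0. Qed.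

Lemma expi_mulrn t n : expi (t *+ n) = expi t ^+ n.
Proof. by elim: n => [|n IH]; rewrite ?expi0 // mulrS expiD IH exprS. Qed.

Lemma norm_expi t : `|expi t| = 1.
Proof. by rewrite normc_def /= cos2Dsin2 sqrtr1. Qed.

Lemma expiN t : expi (- t) * expi t = 1.
Proof. by rewrite -expiD addNr expi0. Qed.

Lemma unit_expi (u : R[i]) : `|u| = 1 -> exists t, u = expi t.
Proof.
case: u => a b u1.
have ab1 : a ^+ 2 + b ^+ 2 = 1.
  by apply: complexI; rewrite (add_Re2_Im2 (a +i* b)) u1 expr1n.
have a1 : -1 <= a <= 1.
  rewrite -ler_norml -(@ler_pXn2r _ 2) ?nnegrE // real_normK ?num_real //.
  by rewrite expr1n -ab1 lerDl sqr_ge0.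
have sinE : sin (acos a) = `|b|.
  by rewrite sin_acos // -ab1 addrAC subrr add0r sqrtr_sqr.
have cosE : cos (acos a) = a by rewrite acosK.
have [b0|b0] := leP 0 b.
  by exists (acos a); rewrite /expi sinE cosE ger0_norm.
by exists (- acos a); rewrite /expi sinN cosN sinE cosE ltr0_norm // opprK.
Qed.

Lemma expi_neq1 t : 0 < t < 2 * pi -> expi t != 1.
Proof.
move=> /andP[t0 tpi]; apply/negP; rewrite eq_complex /= => /andP[/eqP c1 _].
have : 0 < sin (t / 2) by apply: sin_gt0_pi; rewrite divr_gt0 //= ltr_pdivrMr // mulrC.
have : cos t = cos (t / 2) ^+ 2 - sin (t / 2) ^+ 2.
  by rewrite !expr2 -cosD; congr cos; field.
have := cos2Dsin2 (t / 2).
rewrite c1 => cs s2 s0; have := mulr_gt0 s0 s0; rewrite -expr2; lra.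
Qed.

Lemma expi_root_inj (N m n : nat) : (m < n)%N -> (n < m + N)%N ->
  expi (- (2 * pi * m%:R / N%:R) : R) != expi (- (2 * pi * n%:R / N%:R)).
Proof.
move=> mn nmN; have N0 : (0 < N)%N by lia.
have N0' : 0 < N%:R :> R by rewrite ltr0n.
apply/negP => /eqP mnE.
suff : expi (2 * pi * (n - m)%:R / N%:R : R) == 1.
  apply/negP/expi_neq1; rewrite divr_gt0 ?mulr_gt0 ?pi_gt0 ?ltr0n ?subn_gt0 //=.
  rewrite ltr_pdivrMr // ltr_pM2l ?mulr_gt0 ?pi_gt0 // ltr_nat; lia.
rewrite natrB ?(ltnW mn) //.
rewrite (_ : _ / _ = - (2 * pi * m%:R / N%:R) + 2 * pi * n%:R / N%:R).
  by rewrite expiD mnE expiN.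
by field; rewrite gt_eqF.
Qed.

End Circle.

Section Window.
Variables (R : realType) (W : nat) (w : 'I_W -> R[i]).

Lemma wext_neq0 (s n : nat) : (forall k, w k != 0) -> (n <= s)%N -> (s < n + W)%N ->
  wext w (s%:Z - n%:Z) != 0.
Proof.
move=> w0 ns snW; rewrite subzn //=; case: eqP => // h; exfalso; apply: h; lia.
Qed.

Lemma wext_eq0 (s n : nat) : (s < n)%N || (n + W <= s)%N -> wext w (s%:Z - n%:Z) = 0.
Proof.
have [ns|sn _] := leqP n s.
  by move=> nW; rewrite subzn //=; case: eqP => // h; exfalso; lia.
by rewrite (_ : s%:Z - n%:Z = Negz (n - s).-1) //; lia.
Qed.

End Window.

Section Sections.
Variables (R : realType) (N W L : nat) (w : 'I_W -> R[i]).
Implicit Types x y : 'I_N -> R[i].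

Definition freq (m : nat) : R[i] := expi (- (2 * pi * m%:R / N%:R)).

Definition weight (r a k : nat) : R[i] := wext w ((r * L)%:Z - (a + k)%:Z).

Lemma stft_section_poly x (m r a d : nat) : (a + d < N)%N ->
  (forall n, (n < N)%N -> ~~ (a <= n <= a + d)%N -> wext w ((r * L)%:Z - n%:Z) = 0) ->
  stft L w x m r = freq m ^+ a * (section_poly (weight r a) a d x).[freq m].
Proof.
move=> adN w0; rewrite /section_poly horner_poly mulr_sumr.
pose F n : R[i] := ext x n * wext w ((r * L)%:Z - n%:Z) * freq m ^+ n.
have -> : stft L w x m r = \sum_(0 <= n < N) F n.
  rewrite big_mkord; apply: eq_bigr => n _; rewrite /F ext_ord /freq -expi_mulrn.
  by congr (_ * expi _); rewrite mulNrn -mulr_natr; ring.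
have F0 m1 m2 : (m2 <= a)%N || (a + d < m1)%N && (m2 <= N)%N ->
    \sum_(m1 <= n < m2) F n = 0.
  move=> m12; rewrite big_nat_cond big1 // => n /andP[nm _].
  by rewrite /F w0 ?mulr0 ?mul0r //; lia.
rewrite (big_cat_nat (n := a)) //=; last by lia.
rewrite F0 ?leqnn // add0r (big_cat_nat (n := (a + d.+1)%N)) //=; try lia.
rewrite (F0 _ N) ?addr0; last by lia.
rewrite -[X in \sum_(X <= _ < _) _]add0n big_addn addKn big_mkord.
by apply: eq_bigr => k _; rewrite /F /weight addnC exprD; ring.
Qed.

Lemma section_unique x y (r a d M : nat) : (a + d < N)%N ->
  (forall n, (n < N)%N -> ~~ (a <= n <= a + d)%N -> wext w ((r * L)%:Z - n%:Z) = 0) ->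
  (forall k, (k <= d)%N -> weight r a k != 0) ->
  (d.*2 < M)%N -> (M <= N)%N ->
  (forall m, (1 <= m <= M)%N -> stft_mag L w y m r = stft_mag L w x m r) ->
  (forall n, x n != 0) -> ~ flippable (weight r a) a d x ->
  ext y a = ext x a -> forall k, (k <= d)%N -> ext y (a + k) = ext x (a + k).
Proof.
move=> adN w0 v0 dM MN mags x0 nflip yxa k kd.
set p := section_poly (weight r a) a d x; set q := section_poly (weight r a) a d y.
have xext0 l : (l < N)%N -> ext x l != 0.
  by move=> lN; rewrite -[l]/(val (Ordinal lN)) ext_ord.
have [sp sq] : (size p <= d.+1)%N /\ (size q <= d.+1)%N by rewrite !size_poly.
have szp : size p = d.+1.
  by rewrite size_poly_eq // mulf_neq0 ?v0 ?xext0.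
have p0 : p`_0 != 0.
  by rewrite coef_poly /= mulf_neq0 ?v0 ?xext0 //; lia.
have q0 : q`_0 = p`_0 by rewrite !coef_poly /= addn0 yxa.
pose rs := [seq freq m | m <- iota 1 M].
have freqI : {in iota 1 M &, injective freq}.
  move=> m n; rewrite !mem_iota => mM nM /eqP mn.
  have [mltn|nltm|//] := ltngtP m n.
    by move: mn; rewrite (negPf (expi_root_inj _ mltn _)) //; lia.
  by move: mn; rewrite eq_sym (negPf (expi_root_inj _ nltm _)) //; lia.
have pq : p * conjrev d p = q * conjrev d q.
  apply: (@eq_mul_conjrev _ _ _ _ rs) => //.
  - by rewrite map_inj_in_uniq ?iota_uniq.
  - by rewrite size_map size_iota.
  - by move=> _ /mapP[m _ ->]; apply: norm_expi.
  move=> _ /mapP[m mM ->]; have := mags m.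
  rewrite /stft_mag !(stft_section_poly _ m adN w0) => /(_ _)/eqP.
  rewrite eqrXn2 ?normr_ge0 // !normrM normrX norm_expi expr1n !mul1r => h.
  by apply/esym/eqP/h; move: mM; rewrite mem_iota; lia.
case: (conjrev_factorization szp sq p0 q0 pq) => [pqE|[g [f ?]]]; last first.
  by case: nflip; exists g, f.
have := congr1 (fun u : {poly R[i]} => u`_k) pqE.
by rewrite !coef_poly ltnS kd => /(mulIf (v0 _ kd)).
Qed.

End Sections.

Theorem theorem1 (R : realType) (N W L M : nat) (w : 'I_W -> R[i]) :
  (0 < N)%N -> (0 < W)%N -> (0 < L)%N -> (0 < M)%N ->
  (forall n, w n != 0) ->
  (L < W)%N -> (2 * W <= N)%N ->
  (2 * W <= M)%N -> (M <= N)%N ->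
  exists E : ('I_N -> R[i]) -> Prop,
    lebesgue_null E /\
    forall x : 'I_N -> R[i], (forall n, x n != 0) -> ~ E x ->
    forall y : 'I_N -> R[i],
      (forall m r, (1 <= m <= M)%N -> (r < nsect N W L)%N ->
         stft_mag L w y m r = stft_mag L w x m r) ->
      exists phi : R, y = (fun n => expi phi * x n).
Proof.
move=> N0 W0 L0 M0 w0 LW WN WM MN.
pose start r := ((r * L).+1 - W)%N.
pose len r := (minn (r * L) N.-1 - start r)%N.
pose bad r (x : 'I_N -> R[i]) := (forall n, x n != 0) /\
  flippable (weight L w r (start r)) (start r) (len r) x.
have startN r : (r < nsect N W L)%N -> (start r + len r < N)%N /\
    (start r + len r)%N = minn (r * L) N.-1.
  rewrite /nsect leq_divRL // => rR; rewrite /len subnKC.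
    by split=> //; lia.
  by rewrite /start; lia.
have weight0 r k : (r < nsect N W L)%N -> (k <= len r)%N ->
    weight L w r (start r) k != 0.
  move=> /startN[_ slE] kl; apply: wext_neq0 => //; first lia.
  by rewrite /start; lia.
have outside r n : (r < nsect N W L)%N -> (n < N)%N ->
    ~~ (start r <= n <= start r + len r)%N -> wext w ((r * L)%:Z - n%:Z) = 0.
  move=> /startN[_ ->] nN h; apply: wext_eq0.
  by move: h; rewrite /start; lia.
exists (fun x => exists r, (r < nsect N W L)%N /\ bad r x); split.
  apply: lebesgue_null_bigcup => // r.
  have [rR|rR] := ltnP r (nsect N W L).
    apply: (lebesgue_null_sub (S := bad r)) => [z []|] //.
    apply: lebesgue_null_flippable => [|k kl]; first by case: (startN r rR).
    exact: weight0.
  apply: (lebesgue_null_sub (S := fun _ => False)) => [z []|] //.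
  exact: lebesgue_null_empty.
move=> x x0 nE y mags.
have R0 : (0 < nsect N W L)%N by rewrite /nsect divn_gt0 //; lia.
pose i0 := Ordinal N0.
have y0x0 : `|y i0| = `|x i0|.
  have st z : `|stft L w z 1 0| = `|z i0| * `|wext w (0%N%:Z - 0%N%:Z)|.
    rewrite /stft (bigD1 i0) //= big1 => [|n ni0].
      by rewrite addr0 !normrM norm_expi mulr1.
    rewrite wext_eq0 ?mulr0 ?mul0r // mul0n lt0n.
    by apply/orP; left; apply: contraNneq ni0 => n0; apply/eqP/val_inj.
  have /eqP : stft_mag L w y 1 0 = stft_mag L w x 1 0 by apply: mags; lia.
  rewrite /stft_mag eqrXn2 ?normr_ge0 // !st => /eqP/mulIf; apply.
  by rewrite normr_eq0; apply: wext_neq0.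
have [t tE] : exists t, y i0 / x i0 = expi t.
  by apply: unit_expi; rewrite normf_div y0x0 divff // normr_eq0.
exists t; apply/funext => n0.
pose y' n := expi (- t) * y n.
suff y'x r : (r < nsect N W L)%N -> forall n : 'I_N, (n <= r * L)%N -> y' n = x n.
  have nlast : (n0 <= (nsect N W L).-1 * L)%N.
    have := ltn_ceil (N + W - 1 + (L - 1)) L0; rewrite -/(nsect N W L).
    case: (nsect N W L) R0 => // k _ /=; have := ltn_ord n0.
    by rewrite !mulSn; lia.
  rewrite -(y'x (nsect N W L).-1) ?prednK //.
  by rewrite /y' mulrA [expi t * _]mulrC expiN mul1r.
elim: r => [_ n|r IH rR n nr].
  rewrite mul0n leqn0 => /eqP n00.
  have -> : n = i0 by apply: val_inj.
  by rewrite /y' -[y i0](divfK (x0 i0)) tE mulrA expiN mul1r.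
have {}IH := IH (ltnW rR).
have [nr'|nr'] := leqP n (r * L); first exact: IH.
have [slN slE] := startN _ rR.
have [ns|sn] := ltnP n (start r.+1).
  by apply: IH; move: ns; rewrite /start mulSn; lia.
have aN : (start r.+1 < N)%N by lia.
have := @section_unique R N W L w x y' r.+1 (start r.+1) (len r.+1) M slN
  (fun n => outside r.+1 n rR) (fun k => weight0 r.+1 k rR).
move=> /(_ _ MN _ x0 _ _ (n - start r.+1)%N); rewrite subnKC // !ext_ord; apply.
- by rewrite /len /start; lia.
- move=> m mM; rewrite -(mags m r.+1 mM rR) /stft_mag.
  rewrite (_ : stft L w y' m r.+1 = expi (- t) * stft L w y m r.+1).
    by rewrite normrM norm_expi mul1r.
  by rewrite /stft mulr_sumr; apply: eq_bigr => l _; rewrite /y' !mulrA.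
- by move=> fl; apply: nE; exists r.+1.
- rewrite -[start r.+1]/(val (Ordinal aN)) !ext_ord; apply: IH => /=.
  by rewrite /start mulSn; lia.
by have := ltn_ord n; lia.
Qed.
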